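(* Let $H$ be an $n$-cycle on the vertex set $\{1,\dots,n\}$, with the vertices placed at equally spaced points on a circle $C$ in the clockwise order given by $H$. Let $a,b,c,d$ be vertices such that $(a,H(c))$, $(c,H(a))$, $(b,H(d))$, $(d,H(b))$ are all proper, distinct chords in $C$. Then $(a\ c)(b\ d)$ is an $H$-admissible product of two disjoint 2-cycles if and only if $a,b,c,d$ are distinct points such that the chords $(a,c)$ and $(b,d)$ properly intersect in the interior of $C$.
   Context: A product of two disjoint 2-cycles $(a\ c)(b\ d)$ is called $H$-admissible if $H(a\ c)(b\ d)$ is again an $n$-cycle. Here $Hs$ denotes the permutation $v\mapsto H(s(v))$. Two chords properly intersect if they intersect and have no endpoint in common. *)

(* Defs.v *)
From HB Require Import structures.
From mathcomp Require Import all_boot all_order all_algebra all_fingroup.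
From mathcomp Require Import all_classical all_reals all_analysis.
Import Order.TTheory GRing.Theory Num.Theory.

Set Implicit Arguments.
Unset Strict Implicit.
Unset Printing Implicit Defensive.

Local Open Scope classical_set_scope.
Local Open Scope ring_scope.

(* The vertices {1, ..., n} are represented by 'I_n. *)
Definition n_cycle (n : nat) (s : {perm 'I_n}) : Prop :=
  porbits s = [set [set: 'I_n]]%SET.

Definition disjoint_2cycles (n : nat) (a c b d : 'I_n) : bool :=
  [&& a != c, b != d & [disjoint [set a; c]%SET & [set b; d]%SET]].

(* Products in {perm _} compose from left to right, (s * H) v = H (s v), so
   the permutation written Hs with the maps composed as v |-> H (s v) is s * H. *)
Definition admissible_2cycles (n : nat) (H : {perm 'I_n}) (a c b d : 'I_n) : Prop :=
  disjoint_2cycles a c b d /\ n_cycle (tperm a c * tperm b d * H)%g.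

Section Circle.
Variable R : realType.
Implicit Types (o u v w z : R * R) (r theta : R).

Definition circle_point o r theta : R * R :=
  (o.1 + r * cos theta, o.2 + r * sin theta).

Definition circle_interior o r : set (R * R) :=
  [set p | (p.1 - o.1) ^+ 2 + (p.2 - o.2) ^+ 2 < r ^+ 2].

(* Applying H moves the point by the angle 2 pi / n clockwise, i.e. in the
   direction of decreasing angles. *)
Definition clockwise_placement (n : nat) (H : {perm 'I_n}) o r
    (pos : 'I_n -> R * R) : Prop :=
  exists (v0 : 'I_n) (theta : R), forall k : nat,
    pos ((H ^+ k)%g v0) = circle_point o r (theta - 2 * pi * k%:R / n%:R).

(* Chords are undirected: chord u v and chord v u are the same set. *)
Definition chord u v : set (R * R) :=
  [set ((1 - t) * u.1 + t * v.1, (1 - t) * u.2 + t * v.2) | t in `[0, 1]].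

Definition proper_chord u v : bool := u != v.

Definition properly_intersect_in (D : set (R * R)) u v w z : Prop :=
  [/\ u != w, u != z, v != w, v != z & chord u v `&` chord w z `&` D !=set0].

End Circle.

(* Main.v *)
(* For a <> c on the n-cycle H, the permutation H (a c) has exactly two cycles,
   the two arcs into which a and c cut H.  Multiplying by (b d) merges them into
   one n-cycle when b and d lie on different arcs, and otherwise splits one of
   them further.  In the plane, for points at the angles x, y, z of a circle of
   radius r, twice the signed area of their triangle is
   4 r^2 sin((y - x)/2) sin((z - y)/2) sin((z - x)/2).  So b and d lie on
   different arcs exactly when they are on different sides of the line (a c),
   and then the segment [b, d] meets that line inside the disc, hence on the
   chord. *)
Require Import Defs.
From mathcomp Require Import all_boot all_order all_algebra all_fingroup.
From mathcomp Require Import all_classical all_reals all_analysis.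
From mathcomp Require Import ring lra zify.
Import Order.TTheory GRing.Theory Num.Theory.
Set Implicit Arguments.
Unset Strict Implicit.
Unset Printing Implicit Defensive.

Local Open Scope ring_scope.

(** * Orbits of a permutation multiplied by transpositions *)

Lemma porbit_expg_inj (T : finType) (s : {perm T}) (x : T) (i j : nat) :
  (i < #|porbit s x|)%N -> (j < #|porbit s x|)%N ->
  (s ^+ i)%g x = (s ^+ j)%g x -> i = j.
Proof.
move=> ltiN ltjN; rewrite !permX => eq_ij.
apply/eqP; rewrite -(nth_uniq x _ _ (uniq_traject_porbit s x)) ?size_traject //.
by rewrite !nth_traject ?eq_ij.
Qed.

(** The product sends [x] to [s y] and then agrees with [s] until [x] or [y] is met. Only exponents
    below [k] must avoid them, so the end of an arc is covered too. *)
Lemma porbit_tperm_arc (T : finType) (s : {perm T}) (x y : T) (k : nat) :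
  (0 < k)%N ->
  (forall i, (0 < i < k)%N -> (s ^+ i)%g y != x /\ (s ^+ i)%g y != y) ->
  (s ^+ k)%g y \in porbit (tperm x y * s)%g x.
Proof.
case: k => // k _; elim: k => [|k IHk] avoid.
  by apply/porbitP; exists 1%N; rewrite !expg1 permM tpermL.
have /porbitP[j sk] : (s ^+ k.+1)%g y \in porbit (tperm x y * s)%g x.
  by apply: IHk => i /andP[i0 /ltnW ik]; apply: avoid; rewrite i0.
apply/porbitP; exists j.+1.
have [neqx neqy] := avoid k.+1 (leqnn _).
by rewrite (expgSr _ k.+1) (expgSr _ j) !permM -sk tpermD // eq_sym.
Qed.

(** By counting orbits: the transposition splits one orbit of [s] in two, and applying it again
    restores [s], so the second application has to merge two orbits. *)
Lemma notin_porbit_tperm_mul (T : finType) (s : {perm T}) (x y : T) :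
  x != y -> x \in porbit s y -> x \notin porbit (tperm x y * s)%g y.
Proof.
move=> neq_xy s_xy.
have := porbits_mul_tperm s x y; have := porbits_mul_tperm (tperm x y * s)%g x y.
rewrite /= mulgA tperm2 mul1g s_xy neq_xy /=.
by case: (x \notin _) => //=; lia.
Qed.

(* The cycle of s through x is cut into the arcs s x, ..., y and s y, ..., x. *)
Lemma mem_porbit_tperm_mul (T : finType) (s : {perm T}) (x : T) (m i j : nat) :
  let N := #|porbit s x| in
  let y := (s ^+ m)%g x in
  (0 < m < N)%N -> (0 < i < N)%N -> (0 < j < N)%N -> i != m -> j != m ->
  ((s ^+ i)%g x \in porbit (tperm x y * s)%g ((s ^+ j)%g x))
    = ((i < m)%N == (j < m)%N).
Proof.
move=> N y /andP[m_gt0 ltmN].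
have neq_pow k l : (k < N)%N -> (l < N)%N -> k != l ->
    (s ^+ k)%g x != (s ^+ l)%g x.
  by move=> kN lN; apply: contraNneq => /(porbit_expg_inj kN lN)->.
have neq_pow0 k : (0 < k < N)%N -> (s ^+ k)%g x != x.
  move=> /andP[k0 kN]; rewrite -[X in _ != X](perm1 x) -(expg0 s).
  by rewrite neq_pow ?(ltn_trans k0) // -lt0n.
have neq_xy : x != y by rewrite eq_sym neq_pow0 ?m_gt0.
(* The arc lemma with [x] and [y] exchanged: this arc starts at [s x]. *)
have low k : (0 < k < N)%N -> (k < m)%N ->
    porbit (tperm x y * s)%g ((s ^+ k)%g x) = porbit (tperm x y * s)%g y.
  move=> /andP[k0 kN] ltkm; apply/eqP; rewrite eq_porbit_mem tpermC.
  apply: porbit_tperm_arc => // l /andP[l0 lk].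
  have lm := ltn_trans lk ltkm; have lN := ltn_trans lm ltmN.
  split; first by apply: neq_pow => //; rewrite neq_ltn lm.
  by rewrite neq_pow0 ?l0.
(* The arc lemma counted from [y], using that the [k]-th iterate of [x] is the [(k - m)]-th iterate
   of [y]. *)
have high k : (0 < k < N)%N -> k != m -> (k < m)%N = false ->
    porbit (tperm x y * s)%g ((s ^+ k)%g x) = porbit (tperm x y * s)%g x.
  move=> /andP[k0 kN] neq_km /negbT.
  rewrite -leqNgt leq_eqVlt eq_sym (negPf neq_km) /= => ltmk.
  apply/eqP; rewrite eq_porbit_mem -(subnKC (ltnW ltmk)) expgD permM.
  apply: porbit_tperm_arc => [|l /andP[l0 lk]]; first by rewrite subn_gt0.
  rewrite -permM -expgD.
  have lN : (m + l < N)%N by apply: ltn_trans kN; rewrite -ltn_subRL.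
  split; first by rewrite neq_pow0 // addn_gt0 m_gt0.
  by rewrite neq_pow // neq_ltn orbC -{1}[m]addn0 ltn_add2l l0.
have sep : x \notin porbit (tperm x y * s)%g y.
  by apply: notin_porbit_tperm_mul; rewrite // porbit_sym mem_porbit.
move=> i_bd j_bd neq_im neq_jm; rewrite -eq_porbit_mem.
case: (boolP (i < m)%N) => im; case: (boolP (j < m)%N) => jm.
- by rewrite !low // !eqxx.
- by rewrite low // high ?(negPf jm) // eq_sym eq_porbit_mem (negPf sep).
- by rewrite high ?(negPf im) // low // eq_porbit_mem (negPf sep).
- by rewrite !high ?(negPf im) ?(negPf jm) // !eqxx.
Qed.

Lemma n_cycleE (n : nat) (s : {perm 'I_n}) :
  n_cycle s <-> #|porbits s| = 1%N.
Proof.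
split=> [->|/eqP/cards1P[X sX]]; first by rewrite cards1.
have orbX x : porbit s x = X.
  by apply/set1P; rewrite -sX; apply: imset_f.
rewrite /n_cycle sX; congr [set _]%SET; apply/setP => x.
by rewrite -(orbX x) porbit_id !inE.
Qed.

Lemma n_cycle_porbit (n : nat) (s : {perm 'I_n}) (v : 'I_n) :
  n_cycle s -> porbit s v = [set: 'I_n]%SET.
Proof. by move=> s_cycle; apply/set1P; rewrite -s_cycle; apply: imset_f. Qed.

(** The first transposition raises the number of orbits from 1 to 2; the second brings it to 1 or 3,
    according to whether it merges or splits. *)
Lemma n_cycle_tpermM2 (n : nat) (s : {perm 'I_n}) (a b c d : 'I_n) :
  n_cycle s -> a != c -> b != d ->
  n_cycle (tperm b d * (tperm a c * s))%g <->
  b \notin porbit (tperm a c * s)%g d.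
Proof.
move=> s_cycle neq_ac neq_bd; rewrite n_cycleE.
have := porbits_mul_tperm (tperm a c * s)%g b d.
have := porbits_mul_tperm s a c.
rewrite (n_cycle_porbit c s_cycle) inE neq_ac neq_bd /= addn0 => ->.
rewrite ((n_cycleE s).1 s_cycle).
have arith (k : nat) (e : bool) : (k + e.*2 = 1 + 1 + 1)%N -> k = 1%N <-> e.
  by case: e => /= ?; split=> // *; lia.
exact: arith.
Qed.

(** * Orientation and chords of a circle *)

Section Plane.
Variable R : realType.
Implicit Types (o u v w z : R * R) (r theta : R).

(** Twice the signed area of the triangle, positive when it is counterclockwise. *)
Definition orient u v w : R :=
  (v.1 - u.1) * (w.2 - u.2) - (v.2 - u.2) * (w.1 - u.1).

Definition on_circle o r u : Prop :=
  (u.1 - o.1) ^+ 2 + (u.2 - o.2) ^+ 2 = r ^+ 2.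

Lemma circle_point_on o r theta : on_circle o r (circle_point o r theta).
Proof.
rewrite /on_circle /circle_point /= -[RHS]mulr1 -(cos2Dsin2 theta).
by ring.
Qed.

(** Sum-to-product formulas extract [sin (y - x)] and [sin (z - x)]; the remaining determinant is
    the sine of [(x + z) - (x + y)]. Doubled angles avoid halves. *)
Lemma orient_circle_point o r (x y z : R) :
  orient (circle_point o r (2 * x)) (circle_point o r (2 * y))
         (circle_point o r (2 * z))
    = 4 * r ^+ 2 * (sin (y - x) * sin (z - y) * sin (z - x)).
Proof.
have dcos (p q : R) :
    cos (2 * q) - cos (2 * p) = - 2 * sin (p + q) * sin (q - p).
  rewrite (_ : 2 * q = (p + q) + (q - p)); last by ring.
  rewrite (_ : 2 * p = (p + q) - (q - p)); last by ring.
  by rewrite (cosD (p + q)) (cosB (p + q)); ring.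
have dsin (p q : R) :
    sin (2 * q) - sin (2 * p) = 2 * cos (p + q) * sin (q - p).
  rewrite (_ : 2 * q = (p + q) + (q - p)); last by ring.
  rewrite (_ : 2 * p = (p + q) - (q - p)); last by ring.
  by rewrite (sinD (p + q)) (sinB (p + q)); ring.
have -> : sin (z - y) = sin (x + z) * cos (x + y) - cos (x + z) * sin (x + y).
  by rewrite -sinB; congr sin; ring.
have factor (e p q : R) : (e + r * p) - (e + r * q) = r * (p - q) by ring.
by rewrite /orient /= !factor !dcos !dsin; ring.
Qed.

Lemma orient_comb u v w z (t : R) :
  orient u v ((1 - t) * w.1 + t * z.1, (1 - t) * w.2 + t * z.2)
    = (1 - t) * orient u v w + t * orient u v z.
Proof. by rewrite /orient /=; ring. Qed.

(** The squared distance to the centre is [r ^+ 2] minus [t * (1 - t)] times the squared chord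
    length. Here [t] is any real, so the lemma also locates a point of the line on the chord. *)
Lemma circle_interior_comb o r u v (t : R) :
  on_circle o r u -> on_circle o r v -> u != v ->
  circle_interior o r ((1 - t) * u.1 + t * v.1, (1 - t) * u.2 + t * v.2)
    <-> 0 < t * (1 - t).
Proof.
rewrite /on_circle => u_on v_on neq_uv; rewrite /circle_interior /=.
have d_gt0 : 0 < (u.1 - v.1) ^+ 2 + (u.2 - v.2) ^+ 2.
  rewrite lt_def addr_ge0 ?sqr_ge0 // andbT paddr_eq0 ?sqr_ge0 // !sqrf_eq0 !subr_eq0.
  by case: u v neq_uv {u_on v_on} => [u1 u2] [v1 v2]; rewrite -pair_eqE.
have -> : ((1 - t) * u.1 + t * v.1 - o.1) ^+ 2 + ((1 - t) * u.2 + t * v.2 - o.2) ^+ 2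
  = r ^+ 2 - t * (1 - t) * ((u.1 - v.1) ^+ 2 + (u.2 - v.2) ^+ 2).
  transitivity ((1 - t) * r ^+ 2 + t * r ^+ 2
    - t * (1 - t) * ((u.1 - v.1) ^+ 2 + (u.2 - v.2) ^+ 2)); last by ring.
  by rewrite -{1}u_on -v_on; ring.
by rewrite ltrBlDr ltrDl pmulr_lgt0.
Qed.

Lemma mul_onem_gt0 (t : R) : (0 < t * (1 - t)) = (0 < t < 1).
Proof. by apply/idP/idP => [?|/andP[? ?]]; [apply/andP; split|]; nra. Qed.

Lemma properly_intersect_orient o r u v w z :
  on_circle o r u -> on_circle o r v -> on_circle o r w -> on_circle o r z ->
  orient u v w != 0 -> orient u v z != 0 ->
  properly_intersect_in (circle_interior o r) u v w z <->
  orient u v w * orient u v z < 0.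
Proof.
move=> u_on v_on w_on z_on w_side z_side; split.
  case=> _ _ _ _ [p [[[l _ <-] [t /= /andP[t_ge0 t_le1] p_wz]] _]].
  rewrite !bnd_simp in t_ge0 t_le1.
  have : (1 - t) * orient u v w + t * orient u v z = 0.
    by rewrite -orient_comb p_wz /orient /=; ring.
  move=> mean0; rewrite ltNge; apply/negP => same_side.
  have wz_gt0 : 0 < orient u v w * orient u v z by rewrite lt_def mulf_neq0.
  (* Multiplying the vanishing mean by [orient u v w] makes it a convex combination of two positive
     numbers. *)
  have : 0 < (1 - t) * orient u v w ^+ 2 + t * (orient u v w * orient u v z).
    have w2_gt0 : 0 < orient u v w ^+ 2 by rewrite exprn_even_gt0.
    nra.
  suff -> : (1 - t) * orient u v w ^+ 2 + t * (orient u v w * orient u v z)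
    = orient u v w * ((1 - t) * orient u v w + t * orient u v z).
    by rewrite mean0 mulr0 ltxx.
  by ring.
move=> opposite.
have orient_uu : orient u v u = 0 by rewrite /orient; ring.
have orient_vv : orient u v v = 0 by rewrite /orient; ring.
have neq_side x y : orient u v x = 0 -> orient u v y != 0 -> x != y.
  by move=> x0; apply: contraNneq => <-; rewrite x0.
have neq_wz : w != z.
  by apply/eqP => eq_wz; move: opposite; rewrite eq_wz ltNge -expr2 sqr_ge0.
have neq_uv : u != v.
  by apply: contraNneq w_side => ->; rewrite /orient; apply/eqP; ring.
split; try by apply: neq_side.
set D := orient u v w - orient u v z.
have D_neq0 : D != 0.
  apply/eqP => /eqP; rewrite subr_eq0 => /eqP eq_side.
  by move: opposite; rewrite eq_side ltNge -expr2 sqr_ge0.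
(* Parameters of the common point of the two lines: [t] is the zero of [orient u v] along the line
   [w z], and [l] that of [orient w z] along [u v], where the denominator becomes [- D]. *)
pose t := orient u v w / D; pose l := orient w z u / - D.
have on_both : ((1 - l) * u.1 + l * v.1, (1 - l) * u.2 + l * v.2)
             = ((1 - t) * w.1 + t * z.1, (1 - t) * w.2 + t * z.2).
  by rewrite /t /l /D /orient in D_neq0 *; congr pair; field.
have t_in : 0 < t * (1 - t).
  have -> : t * (1 - t) = - (orient u v w * orient u v z) / D ^+ 2.
    by rewrite /t /D in D_neq0 *; field.
  by rewrite divr_gt0 ?oppr_gt0 // exprn_even_gt0.
have p_in := (circle_interior_comb t w_on z_on neq_wz).2 t_in.
(* The point is interior to the disc as a point of [w z], hence lies strictly between [u] and
   [v]. *)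
have l_in : 0 < l * (1 - l).
  by apply/(circle_interior_comb l u_on v_on neq_uv); rewrite on_both.
rewrite !mul_onem_gt0 in t_in l_in.
exists ((1 - t) * w.1 + t * z.1, (1 - t) * w.2 + t * z.2); split=> //; split.
  by exists l => //=; case/andP: l_in => *; rewrite in_itv /= !ltW.
by exists t => //=; case/andP: t_in => *; rewrite in_itv /= !ltW.
Qed.

Lemma clockwise_placement_expg (n : nat) (s : {perm 'I_n}) o r
    (pos : 'I_n -> R * R) (x : 'I_n) :
  n_cycle s -> clockwise_placement s o r pos ->
  exists theta, forall k : nat,
    pos ((s ^+ k)%g x) = circle_point o r (2 * (theta - pi * k%:R / n%:R)).
Proof.
move=> s_cycle [v0 [theta pos_v0]].
have /porbitP[l ->] : x \in porbit s v0 by rewrite n_cycle_porbit // inE.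
exists (theta / 2 - pi * l%:R / n%:R) => k.
rewrite -permM -expgD pos_v0 natrD; congr circle_point.
by field; rewrite pnatr_eq0 -lt0n (leq_ltn_trans _ (ltn_ord v0)).
Qed.

(** The half-angles between the points are multiples of [pi / n]. The sines for [m] and [i] are
    positive, so the sign is that of the sine for [m - i]. *)
Lemma orient_gt0_expg (n : nat) (s : {perm 'I_n}) o r (pos : 'I_n -> R * R)
    (x : 'I_n) (m i : nat) :
  n_cycle s -> 0 < r -> clockwise_placement s o r pos ->
  (0 < m < n)%N -> (0 < i < n)%N -> i != m ->
  let S := orient (pos x) (pos ((s ^+ m)%g x)) (pos ((s ^+ i)%g x)) in
  S != 0 /\ (0 < S) = (i < m)%N.
Proof.
move=> s_cycle r_gt0 /(clockwise_placement_expg x s_cycle)[theta pos_x].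
move=> /andP[m_gt0 lt_mn] /andP[i_gt0 lt_in] neq_im.
have n_gt0 : (0 < n)%N by apply: leq_ltn_trans lt_mn.
have pin_gt0 : 0 < pi / n%:R :> R by rewrite divr_gt0 ?pi_gt0 ?ltr0n.
have sin_pos k : (0 < k < n)%N -> 0 < sin (pi * k%:R / n%:R : R).
  move=> /andP[k_gt0 lt_kn]; apply: sin_gt0_pi; rewrite mulrAC.
  rewrite mulr_gt0 ?ltr0n //= -[X in _ < X](mulfVK (x := n%:R)) ?pnatr_eq0 -?lt0n //.
  by rewrite ltr_pM2l // ltr_nat.
have sub_nat k l : (l <= k)%N ->
    pi * k%:R / n%:R - pi * l%:R / n%:R = pi * (k - l)%:R / n%:R :> R.
  by move=> le_lk; rewrite natrB //; ring.
have pos_x0 := pos_x 0%N; rewrite expg0 perm1 in pos_x0.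
rewrite /= pos_x0 !pos_x orient_circle_point.
have shift (p q : R) : theta - p - (theta - q) = q - p by ring.
rewrite !shift mulr0 mul0r !sub0r !sinN.
set S := _ * _.
have -> : S = 4 * r ^+ 2 * (sin (pi * m%:R / n%:R) * sin (pi * i%:R / n%:R))
              * sin (pi * m%:R / n%:R - pi * i%:R / n%:R) by rewrite /S; ring.
set K := 4 * _ * _.
have K_gt0 : 0 < K by rewrite !mulr_gt0 ?exprn_gt0 ?sin_pos ?m_gt0 ?i_gt0.
rewrite pmulr_rgt0 // mulf_eq0 gt_eqF //=.
case: (ltngtP i m) neq_im => // [lt_im|lt_mi] _.
  have sin_mi := sin_pos (m - i)%N; rewrite sub_nat 1?ltnW //.
  by rewrite gt_eqF ?sin_mi // subn_gt0 lt_im (leq_ltn_trans (leq_subr _ _)).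
have sin_im := sin_pos (i - m)%N.
rewrite -opprB sinN sub_nat 1?ltnW // oppr_gt0 oppr_eq0.
have {}sin_im : 0 < sin (pi * (i - m)%:R / n%:R : R).
  by rewrite sin_im // subn_gt0 lt_mi (leq_ltn_trans (leq_subr _ _)).
by rewrite gt_eqF // ltNge ltW.
Qed.

End Plane.

(** * From positions on the cycle to the equivalence *)

Lemma n_cycle_expg (n : nat) (s : {perm 'I_n}) (x y : 'I_n) :
  n_cycle s -> exists2 k : nat, (k < n)%N & y = (s ^+ k)%g x.
Proof.
move=> s_cycle.
have : y \in porbit s x by rewrite n_cycle_porbit // inE.
rewrite porbit_traject n_cycle_porbit // cardsT card_ord => /trajectP[k lt_kn ->].
by exists k; rewrite ?permX.
Qed.

Theorem theorem1p2 (R : realType) (n : nat) (H : {perm 'I_n})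
  (o : R * R) (r : R) (pos : 'I_n -> R * R) (a b c d : 'I_n)
  (H_n_cycle : n_cycle H)
  (r_gt0 : 0 < r)
  (pos_clockwise : clockwise_placement H o r pos)
  (proper_chords : [/\ proper_chord (pos a) (pos (H c)),
                       proper_chord (pos c) (pos (H a)),
                       proper_chord (pos b) (pos (H d)) &
                       proper_chord (pos d) (pos (H b))])
  (distinct_chords : uniq [:: chord (pos a) (pos (H c));
                              chord (pos c) (pos (H a));
                              chord (pos b) (pos (H d));
                              chord (pos d) (pos (H b))]) :
  admissible_2cycles H a c b d <->
  (uniq [:: a; b; c; d] /\
   properly_intersect_in (circle_interior o r) (pos a) (pos c) (pos b) (pos d)).
Proof.
have disjE : disjoint_2cycles a c b d = uniq [:: a; b; c; d].
  rewrite /disjoint_2cycles finset.disjoints_subset finset.subUset !finset.sub1set !inE !negb_or /=.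
  rewrite !inE !negb_or (eq_sym c b).
  by do !case: eqVneq => //= ?.
rewrite /admissible_2cycles disjE.
(* Both sides contain distinctness, so it may be assumed. *)
suff core : uniq [:: a; b; c; d] ->
    n_cycle (tperm a c * tperm b d * H)%g <->
    properly_intersect_in (circle_interior o r) (pos a) (pos c) (pos b) (pos d).
  by split=> -[abcd] /(core abcd).
move=> abcd.
have [m lt_mn c_m] := n_cycle_expg a c H_n_cycle.
have [i lt_in b_i] := n_cycle_expg a b H_n_cycle.
have [j lt_jn d_j] := n_cycle_expg a d H_n_cycle.
move: abcd; rewrite /= !inE !negb_or => /and4P[/and3P[ab ac ad] /andP[bc bd] cd _].
have pos_gt0 (k : nat) : a != (H ^+ k)%g a -> (0 < k)%N.
  by case: k => //; rewrite expg0 perm1 eqxx.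
have m0 : (0 < m < n)%N by rewrite pos_gt0 -?c_m.
have i0 : (0 < i < n)%N by rewrite pos_gt0 -?b_i.
have j0 : (0 < j < n)%N by rewrite pos_gt0 -?d_j.
have neq_im : i != m by apply: contraNneq bc => im; rewrite b_i c_m im.
have neq_jm : j != m by apply: contraNneq cd => jm; rewrite d_j c_m jm.
have [b_side b_sign] := orient_gt0_expg a H_n_cycle r_gt0 pos_clockwise m0 i0 neq_im.
have [d_side d_sign] := orient_gt0_expg a H_n_cycle r_gt0 pos_clockwise m0 j0 neq_jm.
have on_C v : on_circle o r (pos v).
  have [theta pos_v] := clockwise_placement_expg v H_n_cycle pos_clockwise.
  by rewrite -(perm1 v) -(expg0 H) pos_v; apply: circle_point_on.
rewrite -c_m -b_i -d_j in b_side b_sign d_side d_sign.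
rewrite (properly_intersect_orient (on_C a) (on_C c) (on_C b) (on_C d) b_side d_side).
(* Disjoint transpositions commute. *)
have -> : (tperm a c * tperm b d * H = tperm b d * (tperm a c * H))%g.
  by rewrite mulgA (conjgC (tperm a c)) tpermJ !tpermD // eq_sym.
rewrite n_cycle_tpermM2 // b_i d_j c_m mem_porbit_tperm_mul //;
  try by rewrite n_cycle_porbit // cardsT card_ord.
(* The arcs of [b] and [d] are now read off as signs of orientations; it remains to compare
   differing signs with a negative product. *)
rewrite -c_m -b_i -d_j -b_sign -d_sign.
have [d_lt0|d_gt0|d0] := ltgtP (orient (pos a) (pos c) (pos d)) 0.
- by rewrite nmulr_llt0 //; case: ltP.
- rewrite pmulr_llt0 // ltNge le_eqVlt eq_sym (negPf b_side) /=.
  by case: ltP.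
- by rewrite d0 eqxx in d_side.
Qed.
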